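(* The density $\frac{64}{81}$ is not a jump for $r=3$. That is, for every $c>0$ there exists a family $\mathcal{F}$ of $3$-uniform hypergraphs whose Tur\'an density satisfies $\pi(\mathcal{F})\in\left(\frac{64}{81},\frac{64}{81}+c\right)$.
   Context: An $r$-graph is an $r$-uniform hypergraph. For a family $\mathcal{F}$ of $r$-graphs, $\mathrm{ex}(n,\mathcal{F})$ is the maximum number of edges in an $r$-graph on $n$ vertices containing no member of $\mathcal{F}$ as a subgraph, and the Tur\'an density is $\pi(\mathcal{F})=\lim_{n\to\infty}\mathrm{ex}(n,\mathcal{F})/\binom{n}{r}$ (this limit exists). A number $\alpha\in[0,1)$ is a jump for $r$ if there exists $c>0$ (depending on $\alpha$ and $r$) such that no family $\mathcal{F}$ of $r$-graphs has $\pi(\mathcal{F})\in(\alpha,\alpha+c)$. *)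

(* Defs.v *)
From mathcomp Require Import all_boot all_order all_algebra.
From mathcomp Require Import all_classical all_reals all_analysis.
Set Implicit Arguments.
Unset Strict Implicit.
Unset Printing Implicit Defensive.
Import Order.TTheory GRing.Theory Num.Theory.
Import numFieldNormedType.Exports.
Local Open Scope classical_set_scope.
Local Open Scope ring_scope.

Definition is_uniform (r n : nat) (E : {set {set 'I_n}}) : bool :=
  [forall e in E, #|e| == r].

Definition rgraph (r n : nat) : Type := {E : {set {set 'I_n}} | is_uniform r E}.

Definition edges (r n : nat) (G : rgraph r n) : {set {set 'I_n}} := val G.

(* [H] is a (not necessarily induced) subgraph of [G], up to isomorphism. *)
Definition contains (r m n : nat) (G : rgraph r n) (H : rgraph r m) : Prop :=
  exists f : 'I_m -> 'I_n,
    injective f /\ forall e : {set 'I_m}, e \in edges H -> f @: e \in edges G.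

(* A possibly infinite family of finite [r]-graphs. *)
Definition family (r : nat) : Type := forall m : nat, set (rgraph r m).

Definition is_free (r n : nat) (F : family r) (G : rgraph r n) : Prop :=
  forall (m : nat) (H : rgraph r m), F m H -> ~ contains G H.

(* The maximum over an empty range is 0; this happens only when [F] has an
   edgeless member on at most [n] vertices. *)
Definition turan_number (r n : nat) (F : family r) : nat :=
  \max_(G : rgraph r n | `[< is_free F G >]) #|edges G|.

Definition turan_density (R : realType) (r : nat) (F : family r) : R :=
  limn (fun n : nat => (turan_number n F)%:R / 'C(n, r)%:R : R).

(* Meant for 0 <= alpha < 1. *)
Definition jump (R : realType) (r : nat) (alpha : R) : Prop :=
  exists2 c : R, 0 < c &
    forall F : family r, ~ (alpha < turan_density R F < alpha + c).

Lemma not_jumpP (R : realType) (r : nat) (alpha : R) :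
  ~ jump r alpha <->
  (forall c : R, 0 < c ->
     exists F : family r, alpha < turan_density R F < alpha + c).
Proof.
split=> [nj c c0|h [c c0 hc]]; last by have [F /hc] := h c c0.
by apply: contrapT => nF; apply: nj; exists c => // F hF; apply: nF; exists F.
Qed.

(* Main.v *)
Require Import Defs.
From mathcomp Require Import all_boot all_order all_algebra.
From mathcomp Require Import all_classical all_reals all_analysis.
From mathcomp Require Import ring lra zify.
Set Implicit Arguments.
Unset Strict Implicit.
Unset Printing Implicit Defensive.
Import Order.TTheory GRing.Theory Num.Theory.
Import numFieldNormedType.Exports.
(* [all_boot] also defines [family] and [rgraph]. *)
Import Defs.
Local Open Scope ring_scope.

(** A family of the form "all [m]-vertex 3-graphs with more than [B] edges" has
Turan density at most [B / 'C(m, 3)], and at least the limit density of any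
sequence of 3-graphs whose [m]-vertex subgraphs have at most [B] edges. So it
suffices to find, for every [m], blow-ups of density bounded away from 64/81
from above in which every [m]-vertex subgraph has at most (64/81) m^3/6 edges.

The base pattern has three classes U, V, W of weights 1/9, 4/9, 4/9; its edges
are the triples with exactly one vertex in U, and the triples inside V + W that
meet both V and W. Writing u, v, w for the weights and z = v + w, its density is
3 u z^2 + 3 v w z <= 3 u z^2 + (3/4) z^3 <= 64/81.

Now, following Frankl and Rodl, split V into t points, drop the edges with two
vertices at the same point and one in W, and insert a 3-graph Q on the t points.
With equal weights on the points this gains as soon as Q has more than t^2/2
edges. By random deletion such a Q exists in which any k <= m points span at
most k - 2 edges. If only m points are used, the contribution of Q is then at
most that of a book, 6 x y (v - x - y) for the two weights x, y of largest
product, which is less than the loss unless v - w is large; in that case it is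
compensated by the deviation of (v, w) from its optimum. *)

(** * Edge sums as sums over ordered triples *)

Lemma set3_eq (T : finType) (e : {set T}) (i j k : T) : #|e| = 3%N ->
  ([set i; j; k] == e) = [&& i \in e, j \in e :\ i & k \in e :\ i :\ j].
Proof.
move=> e3; rewrite -finset.setUC; apply/eqP/and3P => [ijk|[ie]].
  have := e3; rewrite -ijk cardsU1 cards2 !inE !eqxx !orbT (eq_sym j).
  by case: (k =P i); case: (i =P j); case: (k =P j).
rewrite !inE => /andP[ji je] /and3P[kj ki ke].
apply/eqP; rewrite eqEcard e3; apply/andP; split.
  by apply/fintype.subsetP => x; rewrite !inE => /or3P[] /eqP->.
by rewrite cardsU1 !inE negb_or ki kj cards2 eq_sym ji.
Qed.

(** Each 3-set has 3 * 2 * 1 orderings, and a triple with a repeated entry never gives an element of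
    [E]. This turns edge counts into polynomials in class sizes later on. *)
Lemma sum_set3 (R : nmodType) (T : finType) (E : {set {set T}}) (f : {set T} -> R) :
  (forall e, e \in E -> #|e| = 3%N) ->
  \sum_i \sum_j \sum_k (if [set i; j; k] \in E then f [set i; j; k] else 0)
    = (\sum_(e in E) f e) *+ 6.
Proof.
move=> E3.
rewrite -sumrMnl.
transitivity (\sum_(e in E) \sum_i \sum_j \sum_k
    (if [set i; j; k] == e then f e else 0)).
  rewrite [RHS]exchange_big /=; apply: eq_bigr => i _.
  rewrite [RHS]exchange_big /=; apply: eq_bigr => j _.
  rewrite [RHS]exchange_big /=; apply: eq_bigr => k _.
  rewrite -big_mkcondr /=; case: ifPn => ijkE.
    by rewrite (big_pred1 [set i; j; k]) // => e /=; rewrite eq_sym andb_idl // => /eqP->.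
  by rewrite big_pred0 // => e; apply/andP => -[eE /eqP ijke]; rewrite ijke eE in ijkE.
apply: eq_bigr => e eE.
have e3 := E3 _ eE.
transitivity (\sum_(i in e) \sum_(j in e :\ i) \sum_(k in e :\ i :\ j) f e).
  rewrite [RHS]big_mkcond; apply: eq_bigr => i _.
  case: ifPn => ie; last first.
    by rewrite big1 // => j _; rewrite big1 // => k _; rewrite set3_eq // (negbTE ie).
  rewrite [RHS]big_mkcond; apply: eq_bigr => j _.
  case: ifPn => je; last first.
    by rewrite big1 // => k _; rewrite set3_eq // (negbTE je) andbF.
  by rewrite [RHS]big_mkcond; apply: eq_bigr => k _; rewrite set3_eq // ie je.
rewrite (eq_bigr (fun=> f e *+ 2)) => [|i ie].
  by rewrite sumr_const e3 -mulrnA.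
have /eqP := cardsD1 i e; rewrite ie e3 add1n eqSS => /eqP ei.
rewrite (eq_bigr (fun=> f e)) => [|j je]; first by rewrite sumr_const -ei.
have /eqP := cardsD1 j (e :\ i); rewrite je -ei add1n eqSS => /eqP eij.
by rewrite sumr_const -eij.
Qed.

(** * Random deletion and sparse triple systems *)

Section Alteration.
Variables (R : realFieldType) (I : finType) (p : R).
Hypothesis p01 : 0 <= p <= 1.

Let mu (J : {set I}) : R := \prod_i (if i \in J then p else 1 - p).

(** [mu] is the law of a random set keeping each point independently with probability [p]. Expanding
    the product of sums kills every [J] that misses a point of [B]. *)
Lemma bernoulli_subset (B : {set I}) :
  \sum_(J : {set I}) mu J * (B \subset J)%:R = p ^+ #|B|.
Proof.
transitivity (\prod_i (p + (if i \in B then 0 else 1 - p))).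
  rewrite bigA_distr; apply: eq_bigr => J _.
  case: (boolP (B \subset J)) => BJ.
    rewrite mulr1; apply: eq_bigr => i _; case: ifPn => // iJ.
    by rewrite ifN //; apply: contra iJ; apply: (fintype.subsetP BJ).
  have /fintype.subsetPn[i iB iJ] := BJ.
  by rewrite mulr0 (bigD1 i) //= (negbTE iJ) iB mul0r.
rewrite (bigID (mem B)) /= [X in _ * X]big1 => [|i /negbTE->]; last by rewrite addrC subrK.
rewrite mulr1 (eq_bigr (fun=> p)) => [|i ->]; last by rewrite addr0.
by rewrite prodr_const.
Qed.

(** The deletion method: some [J0] does at least as well as the mean of the kept points of [D] minus
    the surviving obstructions. Removing one point from each surviving [B k], possible as it is
    nonempty, destroys them all. *)
Lemma alteration (D : {set I}) (K : finType) (C : {set K}) (B : K -> {set I}) :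
    (forall k, k \in C -> B k != finset.set0) ->
  exists J : {set I}, [/\ J \subset D, forall k, k \in C -> ~~ (B k \subset J) &
    p * #|D|%:R - \sum_(k in C) p ^+ #|B k| <= #|J|%:R].
Proof.
move=> B0.
pose bad (J : {set I}) := [set k in C | B k \subset J].
pose f (J : {set I}) : R := #|J :&: D|%:R - #|bad J|%:R.
have mean : \sum_(J : {set I}) mu J * f J = p * #|D|%:R - \sum_(k in C) p ^+ #|B k|.
  under eq_bigr => J _.
    have -> : f J = \sum_(i in D) ([set i] \subset J)%:R - \sum_(k in C) (B k \subset J)%:R.
      rewrite /f -!sum1_card !natr_sum; congr (_ - _).
        rewrite big_mkcond [RHS]big_mkcond; apply: eq_bigr => i _.
        by rewrite inE finset.sub1set; case: (i \in J); case: (i \in D).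
      rewrite big_mkcond [RHS]big_mkcond; apply: eq_bigr => k _.
      by rewrite inE; case: (k \in C); case: (B k \subset J).
    rewrite mulrBr !mulr_sumr; over.
  rewrite sumrB exchange_big [X in _ - X]exchange_big /=.
  congr (_ - _); last by apply: eq_bigr => k _; exact: bernoulli_subset.
  rewrite (eq_bigr (fun=> p)) => [|i _]; last by rewrite bernoulli_subset cards1 expr1.
  by rewrite sumr_const mulr_natr.
have mu1 : \sum_(J : {set I}) mu J = 1.
  rewrite -(expr0 p) -(cards0 I) -bernoulli_subset.
  by apply: eq_bigr => J _; rewrite finset.sub0set mulr1.
have mu0 J : 0 <= mu J.
  by have /andP[p0 p1] := p01; apply: prodr_ge0 => i _; case: ifP => _; lra.
pose J0 := [arg max_(J > finset.set0 : {set I}) f J]%O.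
have fJ0 J : f J <= f J0 by rewrite /J0; case: arg_maxP => // L _; apply.
have le_f : p * #|D|%:R - \sum_(k in C) p ^+ #|B k| <= f J0.
  rewrite -mean -[leRHS]mul1r -mu1 mulr_suml.
  by apply: ler_sum => J _; exact: ler_wpM2l.
pose pk k := [pick i in B k].
pose del := [set i | [exists k in bad J0, pk k == Some i]].
exists ((J0 :&: D) :\: del); split.
- by apply/fintype.subsetP => i; rewrite !inE => /and3P[].
- move=> k kC; apply/negP => BJ.
  have kJ0 : k \in bad J0.
    by rewrite inE kC; apply/fintype.subsetP => i /(fintype.subsetP BJ); rewrite !inE => /and3P[].
  case E : (pk k) => [i|].
    have iB : i \in B k by move: E; rewrite /pk; case: pickP => // ? ? [<-].
    have := fintype.subsetP BJ _ iB; rewrite !inE => /andP[/negP[]].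
    by apply/existsP; exists k; rewrite kJ0 E eqxx.
  by move: E; rewrite /pk; case: pickP => // Bk0 _; have /finset.set0Pn[i] := B0 _ kC; rewrite Bk0.
- apply: (le_trans le_f); rewrite /f lerBlDr -natrD ler_nat.
  have del_le : (#|del| <= #|bad J0|)%N.
    have Some_inj : injective (@Some I) by move=> x y [].
    rewrite -(card_imset (mem del) Some_inj).
    apply: leq_trans (leq_imset_card pk _).
    apply/subset_leq_card/fintype.subsetP => x /imsetP[i].
    rewrite inE => /existsP[k /andP[kJ /eqP E]] ->.
    by apply/imsetP; exists k.
  rewrite -(cardsID del (J0 :&: D)) addnC leq_add2l.
  apply: leq_trans del_le; apply/subset_leq_card/finset.subsetIr.
Qed.
End Alteration.

Lemma sum_expr_card_le (R : realFieldType) (t m : nat) (p : R) : 0 <= p ->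
  \sum_(A : {set 'I_t} | (#|A| <= m)%N) p ^+ #|A| <= \sum_(k < m.+1) (t%:R * p) ^+ k.
Proof.
move=> p0.
rewrite (partition_big (fun A : {set 'I_t} => inord #|A| : 'I_m.+1) predT) //=.
apply: ler_sum => k _.
rewrite (eq_big (fun A : {set 'I_t} => A \in [set A : {set 'I_t} | #|A| == k])
  (fun=> p ^+ k)); first last.
- by move=> A /andP[Am /eqP<-]; rewrite inordK.
- move=> A; rewrite inE; apply/andP/eqP => [[Am /eqP<-]|Ak]; first by rewrite inordK.
  by rewrite Ak; split; [exact: (ltn_ord k)|apply/eqP/val_inj; rewrite /= inordK].
rewrite sumr_const card_draws card_ord exprMn -[leLHS]mulr_natl -natrX.
apply: ler_wpM2r; first exact: exprn_ge0.
rewrite ler_nat.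
apply: (@leq_trans (t ^_ k)); first by rewrite -bin_ffact leq_pmulr // fact_gt0.
elim: (val k) => // j IH; by rewrite ffactnSr expnSr leq_mul // leq_subr.
Qed.

(** Keep each triple with probability 12/t. About 2 t^2 triples survive, while an obstruction,
    [#|A| - 1] sets inside a small [A], survives with probability p^(|A| - 1). Summed over the t^|A|
    or fewer choices of [A] of a given size, this is only linear in t. *)
Lemma sparse_triples (m : nat) : exists (t : nat) (Q : {set {set 'I_t}}),
  [/\ forall e, e \in Q -> #|e| = 3%N, (t ^ 2 < 2 * #|Q|)%N &
      forall A : {set 'I_t}, (#|A| <= m)%N ->
        (#|[set e in Q | e \subset A]| <= #|A| - 2)%N].
Proof.
(* [K * t] will bound the expected number of obstructions; 2^(2^m) bounds the number of set systems
   on [A]. Taking t = K + 12 lets the quadratic term win and keeps p at most 1. *)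
have [K KE] : exists K, K = (2 ^ (2 ^ m) * \sum_(k < m.+1) 12 ^ k)%N by eexists.
have [t tE] : exists t, t = (K + 12)%N by eexists.
have t0 : (0 < t)%N by rewrite tE addnS.
have [p pE] : exists p : rat, p = 12 / t%:R by eexists.
have tp : t%:R * p = 12 by rewrite pE mulrC divfK // pnatr_eq0 -lt0n.
have p0 : 0 < p by rewrite pE divr_gt0 // ltr0n.
have p01 : 0 <= p <= 1.
  by rewrite ltW //= pE ler_pdivrMr ?ltr0n // mul1r ler_nat tE leq_addl.
pose D := [set e : {set 'I_t} | #|e| == 3%N].
pose C := [set x : {set 'I_t} * {set {set 'I_t}} |
  [&& (2 < #|x.1| <= m)%N, x.2 \subset powerset x.1 & #|x.2| == #|x.1|.-1]].
have [|J [JD JC Jbig]] := @alteration _ _ p p01 D _ C (fun x => x.2).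
  by move=> [A B]; rewrite inE -card_gt0 /= => /and3P[/andP[A2 _] _ /eqP->]; case: #|A| A2 => [|[]].
exists t, J; split.
- by move=> e /(fintype.subsetP JD); rewrite inE => /eqP.
- have bad_le : \sum_(k in C) p ^+ #|k.2| <= K%:R * t%:R.
    apply: (@le_trans _ _ (\sum_(A : {set 'I_t} | (#|A| <= m)%N)
        \sum_(B in powerset (powerset A)) p ^+ #|A| / p)).
      rewrite pair_big_dep /= [leLHS]big_mkcond [leRHS]big_mkcond /=.
      apply: ler_sum => -[A B] _ /=; rewrite !inE /=.
      case: ifPn => [/and3P[/andP[A2 Am] BA /eqP->]|_].
        rewrite Am BA /=; case: #|A| A2 => // a _ /=.
        by rewrite exprSr mulfK // gt_eqF.
      by case: ifP => // _; rewrite divr_ge0 ?exprn_ge0 // ltW.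
    apply: (@le_trans _ _ (\sum_(A : {set 'I_t} | (#|A| <= m)%N)
        p ^+ #|A| * ((2 ^ (2 ^ m))%:R / p))).
      apply: ler_sum => A Am; rewrite sumr_const !card_powerset -[leLHS]mulr_natr -mulrA.
      apply: ler_wpM2l; first by rewrite exprn_ge0 // ltW.
      rewrite mulrC ler_wpM2r ?invr_ge0 ?(ltW p0) // ler_nat.
      by rewrite !leq_pexp2l.
    rewrite -mulr_suml.
    apply: le_trans (ler_wpM2r _ (@sum_expr_card_le _ t m p (ltW p0))) _.
      by rewrite divr_ge0 ?ler0n // ltW.
    have -> : \sum_(k < m.+1) (t%:R * p) ^+ k = (\sum_(k < m.+1) 12 ^ k)%N%:R.
      by rewrite natr_sum; apply: eq_bigr => k _; rewrite tp natrX.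
    rewrite mulrC mulrAC -[X in X / _ <= _]natrM -KE ler_wpM2l ?ler0n //.
    by rewrite pE invf_div ler_pdivrMr // ler_peMr ?ler0n.
  have cardD : #|D| = 'C(t, 3) by rewrite card_draws card_ord.
  have pD : p * #|D|%:R = 2 * (t%:R - 1) * (t%:R - 2).
    have : (6 * #|D|)%N = (t * (t - 1) * (t - 2))%N.
      by rewrite cardD mulnC (bin_ffact t 3) !ffactnS ffactn0 muln1 -!subn1 -subnDA mulnA.
    move=> /(congr1 (fun n => n%:R : rat)); rewrite !natrM.
    rewrite !natrB; [|lia..] => D6.
    have -> : p * #|D|%:R = p / 6 * (6 * #|D|%:R) by field.
    by rewrite D6 -[RHS]mulr1 pE; field; rewrite pnatr_eq0 -lt0n.
  rewrite pD in Jbig.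
  rewrite -(ltr_nat rat) natrX natrM.
  have tK : t%:R = K%:R + 12 :> rat by rewrite tE natrD.
  have K0 : 0 <= K%:R :> rat by rewrite ler0n.
  have K2 : 0 <= K%:R * K%:R :> rat by rewrite mulr_ge0.
  rewrite tK in Jbig bad_le *; lra.
- move=> A Am; rewrite leqNgt; apply/negP => big.
  (* Here the truncated [#|A| - 2] is 0, so one must check that [A] contains no triple at all. *)
  have [A2|A2] := leqP #|A| 2.
    have : [set e in J | e \subset A] = finset.set0.
      apply/setP => e; rewrite !inE; apply/andP => -[/(fintype.subsetP JD)].
      by rewrite inE => /eqP e3 /subset_leq_card; rewrite e3 leqNgt ltnS A2.
    by move=> E; move: big; rewrite E cards0.
  have : (0 < #|[set B : {set {set 'I_t}} |
      B \subset [set e in J | e \subset A] & #|B| == #|A|.-1]|)%N.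
    by rewrite cards_draws bin_gt0; apply: leq_trans big; lia.
  rewrite card_gt0 => /finset.set0Pn[B]; rewrite inE => /andP[BJ BA].
  have /JC : (A, B) \in C.
    rewrite inE /=; apply/and3P; split=> //; first by rewrite A2.
    apply/fintype.subsetP => e /(fintype.subsetP BJ).
    by rewrite !inE => /andP[].
  by case/negP; apply/fintype.subsetP => e /(fintype.subsetP BJ); rewrite inE => /andP[].
Qed.

(** * Monotonicity of Turan ratios and bounds on the density *)

Section Turan.
Variable r : nat.

Lemma leq_turan_number n (F : family r) (G : rgraph r n) :
  is_free F G -> (#|edges G| <= turan_number n F)%N.
Proof. by move=> FG; apply: (leq_bigmax_cond G); exact/asboolP. Qed.

Lemma del_vertex_uniform n (G : rgraph r n.+1) (v : 'I_n.+1) :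
  is_uniform r [set e : {set 'I_n} | lift v @: e \in edges G].
Proof.
apply/forallP => e; apply/implyP; rewrite inE => eG.
have /forallP/(_ (lift v @: e))/implyP/(_ eG) := valP G.
by rewrite card_imset //; exact: lift_inj.
Qed.

Definition del_vertex n (G : rgraph r n.+1) (v : 'I_n.+1) : rgraph r n :=
  exist (fun E => is_uniform r E) _ (del_vertex_uniform G v).

Lemma free_del_vertex n (F : family r) (G : rgraph r n.+1) (v : 'I_n.+1) :
  is_free F G -> is_free F (del_vertex G v).
Proof.
move=> FG m H /FG HG [f [f_inj fE]]; apply: HG.
exists (lift v \o f); split; first exact: (inj_comp (@lift_inj _ v) f_inj).
by move=> e /fE; rewrite inE -imset_comp.
Qed.

(** Double counting of pairs of a vertex and an edge avoiding it. *)
Lemma sum_del_vertex n (G : rgraph r n.+1) :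
  (\sum_v #|edges (del_vertex G v)| = #|edges G| * (n.+1 - r))%N.
Proof.
transitivity (\sum_v \sum_(e in edges G) (v \notin e))%N.
  apply: eq_bigr => v _.
  have lift_im_inj : injective (fun e : {set 'I_n} => lift v @: e).
    exact: (imset_inj (@lift_inj _ v)).
  rewrite -(card_imset (mem (edges (del_vertex G v))) lift_im_inj) -sum1_card.
  rewrite -big_mkcondr /=; apply: eq_bigl => e.
  apply/imsetP/andP => [[e' ] | [eG ve]].
    rewrite inE => e'G ->; split=> //.
    by apply/imsetP => -[x _ /eqP]; rewrite (negbTE (neq_lift _ _)).
  have eE : e = lift v @: (lift v @^-1: e).
    apply/setP => x; apply/idP/imsetP => [xe|[y]]; last by rewrite inE => ? ->.
    case: (unliftP v x) => [y xy|xv]; last by rewrite -xv xe in ve.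
    by exists y => //; rewrite inE -xy.
  by exists (lift v @^-1: e) => //; rewrite inE -eE.
rewrite exchange_big -sum_nat_const /=; apply: eq_bigr => e eG.
have /forallP/(_ e)/implyP/(_ eG)/eqP er := valP G.
rewrite -[X in (X - r)%N]card_ord -er -(cardsC e) addKn -sum1_card [RHS]big_mkcond /=.
by apply: eq_bigr => v _; rewrite inE; case: (v \in e).
Qed.

Lemma turan_number_averaging n (F : family r) :
  (turan_number n.+1 F * (n.+1 - r) <= n.+1 * turan_number n F)%N.
Proof.
rewrite {1}/turan_number; elim/big_ind: _ => [//|x y|G /asboolP FG].
  by move=> ? ?; case: (leqP x y) => _.
rewrite -sum_del_vertex -[n.+1 in leqRHS]card_ord -sum_nat_const.
by apply: leq_sum => v _; exact/leq_turan_number/free_del_vertex.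
Qed.

Variables (R : realType) (F : family r).
Let ratio n : R := (turan_number n F)%:R / 'C(n, r)%:R.

Lemma turan_ratioS n : (r <= n)%N -> ratio n.+1 <= ratio n.
Proof.
move=> rn; rewrite /ratio.
rewrite ler_pdivrMr ?ltr0n ?bin_gt0 ?leqW //.
rewrite mulrAC ler_pdivlMr ?ltr0n ?bin_gt0 //.
rewrite -!natrM ler_nat -(@leq_pmul2l (n.+1 - r)%N) ?subn_gt0 //.
apply: (@leq_trans (turan_number n.+1 F * (n.+1 - r) * 'C(n, r))).
  by rewrite mulnA (mulnC (n.+1 - r)%N).
apply: leq_trans (leq_mul (turan_number_averaging n F) (leqnn _)) _.
by rewrite [leqRHS]mulnCA -mul_bin_down /= mulnA (mulnC n.+1).
Qed.

(** The shift skips the indices below [r], where the binomial is 0 and the ratio is 0 by the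
    convention for division, which would break monotonicity. *)
Let shifted_nonincreasing : nonincreasing_seq (fun n => ratio (n + r)%N).
Proof. by apply/nonincreasing_seqP => n; apply: turan_ratioS; rewrite leq_addl. Qed.

Let shifted_cvg : cvgn (fun n => ratio (n + r)%N).
Proof.
apply: nonincreasing_is_cvgn => //; exists 0 => _ [n _ <-].
by rewrite divr_ge0.
Qed.

Let turan_densityE : turan_density R F = limn (fun n => ratio (n + r)%N).
Proof.
by apply/cvg_lim => //; have := shifted_cvg; rewrite cvg_shiftn.
Qed.

Lemma turan_density_le n : (r <= n)%N -> turan_density R F <= ratio n.
Proof.
by move=> rn; rewrite turan_densityE -(subnK rn); exact: nonincreasing_cvgn_ge.
Qed.

Lemma turan_density_ge (a : R) :
  (forall N, exists2 n, (N <= n)%N & a <= ratio n) -> a <= turan_density R F.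
Proof.
move=> ua; rewrite turan_densityE; apply: limr_ge => //.
apply: nearW => n; have [k nk ak] := ua (n + r)%N.
apply: le_trans ak _; rewrite -(subnK (leq_trans (leq_addl n r) nk)).
by apply: shifted_nonincreasing; rewrite leq_subRL ?(leq_trans _ nk) ?leq_addl // addnC.
Qed.

End Turan.

(** * Weight inequalities behind the upper bound *)

Lemma sum_ltn_ord (m k : nat) : (k <= m)%N -> (\sum_(i < m) (i < k) = k)%N.
Proof.
move=> km; rewrite (eq_bigr (fun i : 'I_m => if (i < k)%N then 1%N else 0%N)) => [|i _].
  by rewrite -big_mkcond /= (big_ord_narrow km) sum1_card card_ord.
by case: (i < k)%N.
Qed.

(* Layer cake over the level sets of [a]: at every level the sparsity of [Q]
   beats the count of points outside the heaviest pair. *)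
Lemma sparse_weight_le (I : finType) (Q : {set {set I}}) (m : nat) (a : I -> nat) :
    (forall e, e \in Q -> #|e| = 3%N) ->
    (forall A : {set I}, (#|A| <= m)%N -> (#|[set e in Q | e \subset A]| <= #|A| - 2)%N) ->
    (\sum_p a p <= m)%N ->
  exists x y : nat, [/\ (x + y <= \sum_p a p)%N, (x ^ 2 + y ^ 2 <= \sum_p a p ^ 2)%N &
    (\sum_p \sum_q \sum_r (if [set p; q; r] \in Q then a p * a q * a r else 0)
      <= 6 * (x * y) * (\sum_p a p - x - y))%N].
Proof.
move=> Q3 Qsparse am.
have [x0 x0P|noP] := pickP (fun x : I * I => x.1 != x.2); last first.
  exists 0%N, 0%N; split => //; rewrite big1 // => p _; rewrite big1 // => q _.
  rewrite big1 // => r _; case: ifPn => // /Q3.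
  have /negbFE/eqP/= <- := noP (p, q); have /negbFE/eqP/= <- := noP (p, r).
  by rewrite finset.setUid cards2; case: (_ != _).
pose f (x : I * I) := (a x.1 * a x.2)%N.
case: (@arg_maxnP _ x0 (fun x => x.1 != x.2) f x0P) => -[s t] /= st fmax {x0 x0P}.
have sum_st (F : I -> nat) : (\sum_p F p = F s + F t + \sum_(p | (p != s) && (p != t)) F p)%N.
  by rewrite (bigD1 s) //= (bigD1 t) /= ?(eq_sym t) // addnA.
exists (a s), (a t); split; first by rewrite sum_st leq_addr.
  by rewrite (sum_st (fun p => a p ^ 2)%N) leq_addr.
pose level (i : nat) := [set p | (i < a p)%N].
pose depth (e : {set I}) := (\sum_(i < m) (e \subset level i))%N.
have a_le p : (a p <= m)%N by apply: leq_trans am; rewrite (bigD1 p) //= leq_addr.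
(* In a product of three weights the two largest multiply to at most [a s * a t]; the smallest is
   [depth], the number of level sets containing all three points. *)
apply: (@leq_trans (\sum_p \sum_q \sum_r
    (if [set p; q; r] \in Q then a s * a t * depth [set p; q; r] else 0))).
  apply: leq_sum => p _; apply: leq_sum => q _; apply: leq_sum => r _.
  case: ifPn => // /Q3; rewrite -finset.setUC cardsU1 cards2 !inE => pqr.
  have {pqr}[pq pr qr] : [/\ p != q, p != r & q != r].
    by move: pqr; rewrite (eq_sym p r) (eq_sym q r);
      case: (r == p); case: (r == q); case: (p == q).
  have -> : depth (r |: [set p; q]) = minn (a p) (minn (a q) (a r)).
    rewrite -[RHS](@sum_ltn_ord m); last by rewrite geq_min a_le.
    apply: eq_bigr => i _; congr (nat_of_bool _).
    by rewrite !finset.subUset !finset.sub1set !inE !leq_min andbC andbA.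
  have := fmax (p, q) pq; have := fmax (p, r) pr; have := fmax (q, r) qr.
  rewrite /f /= => qrM prM pqM.
  rewrite /minn; case: (ltnP (a q)) => _; case: ltnP => _.
  - by rewrite -mulnA mulnC leq_mul.
  - by rewrite mulnAC leq_mul.
  - by rewrite -mulnA mulnC leq_mul.
  - by rewrite leq_mul.
suff depth_le : (\sum_(e in Q) depth e <= \sum_p a p - a s - a t)%N.
  rewrite (sum_set3 (fun e => a s * a t * depth e)%N Q3) -mulr_natl natn.
  rewrite -[leqLHS]/(6 * \sum_(e in Q) (a s * a t * depth e))%N -big_distrr /=.
  by rewrite -!mulnA !leq_mul2l depth_le !orbT.
rewrite exchange_big /=.
(* Both sides are now sums over levels, so it remains to compare at each level the edges of [Q]
   inside it with its points other than [s] and [t]. *)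
have -> : (\sum_p a p - a s - a t = \sum_(i < m) #|level i :\: [set s; t]|)%N.
  rewrite (sum_st a) -subnDA addKn.
  transitivity (\sum_(p | (p != s) && (p != t)) \sum_(i < m) (i < a p))%N.
    by apply: eq_bigr => p _; rewrite sum_ltn_ord.
  rewrite exchange_big; apply: eq_bigr => i _ /=.
  rewrite -sum1_card big_mkcond [RHS]big_mkcond; apply: eq_bigr => p _.
  by rewrite !inE negb_or; case: (_ && _) => //=; case: (i < a p)%N.
apply: leq_sum => i _.
have le_m : (#|level i| <= m)%N.
  apply: leq_trans am; rewrite -sum1_card big_mkcond; apply: leq_sum => p _.
  by rewrite inE; case: ltnP => //; apply: leq_trans.
have -> : (\sum_(e in Q) (e \subset level i) = #|[set e in Q | e \subset level i]|)%N.
  rewrite -sum1_card big_mkcond [RHS]big_mkcond; apply: eq_bigr => e _.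
  by rewrite !inE; case: (e \in Q) => //; case: (_ \subset _).
apply: leq_trans (Qsparse _ le_m) _.
rewrite cardsD leq_sub2l //; apply: leq_trans (subset_leq_card (finset.subsetIr _ _)) _.
by rewrite cards2 st.
Qed.

(** First the terms without [u] are bounded by 3/4 z^3 with z = v + w, then [u] is optimised against
    z; equality in the second step occurs at z = 8u. *)
Lemma pattern_poly_le (R : realFieldType) (u v w a b s q : R) :
  0 <= u -> 0 <= w -> 0 <= a -> 0 <= b -> a + b <= v ->
  a ^+ 2 + b ^+ 2 <= s -> q <= 6 * (a * b) * (v - a - b) ->
  3 * u * (v + w) ^+ 2 + 3 * v * w ^+ 2 + 3 * w * (v ^+ 2 - s) + q
    <= 64 / 81 * (u + v + w) ^+ 3.
Proof.
move=> u0 w0 a0 b0 abv abs qab.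
have link_le : 3 * v * w ^+ 2 + 3 * w * (v ^+ 2 - s) + q <= 3 / 4 * (v + w) ^+ 3.
  have ab4 : 4 * (a * b) <= (a + b) ^+ 2 by rewrite -subr_ge0; have := sqr_ge0 (a - b); lra.
  have ab0 : 0 <= a * b by rewrite mulr_ge0.
  (* Since 3/4 z^3 - 3vwz = 3/4 z (v - w)^2 and a^2 + b^2 = (a - b)^2 + 2ab, this is what remains of
     [link_le]. With c = a + b and d = v - w it follows from 3/2 c^2 (d - c) <= 3/4 d^3 and d <= z
     when c < d; otherwise the left side is not positive. *)
  have key : 6 * (a * b) * (v - w - (a + b)) <= 3 / 4 * (v + w) * (v - w) ^+ 2.
    have R0 : 0 <= (v + w) * (v - w) ^+ 2 by rewrite mulr_ge0 ?sqr_ge0 //; lra.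
    have [D0|D0] := leP (v - w) (a + b).
      apply: (@le_trans _ _ 0); last lra.
      by rewrite mulr_ge0_le0 //; lra.
    have vw0 : 0 <= v - w by lra.
    apply: (@le_trans _ _ (3 / 2 * (a + b) ^+ 2 * (v - w - (a + b)))).
      by apply: ler_wpM2r; lra.
    apply: (@le_trans _ _ (3 / 4 * (v - w) ^+ 3)).
      set d := v - w in D0 vw0 *; set c := a + b in D0 *.
      have c0 : 0 <= c by rewrite addr_ge0.
      have h1 : 0 <= (d - c) ^+ 3 by rewrite exprn_ge0 // subr_ge0 ltW.
      have h2 : 0 <= c * (d - c) ^+ 2 by rewrite mulr_ge0 ?sqr_ge0.
      have h3 : 0 <= d * d * c by rewrite !mulr_ge0.
      have h4 : 0 <= c * c * c by rewrite !mulr_ge0.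
      lra.
    rewrite exprS mulrA; apply: ler_wpM2r; first exact: sqr_ge0.
    by apply: ler_wpM2l; lra.
  have ws : w * (a ^+ 2 + b ^+ 2) <= w * s by rewrite ler_wpM2l.
  have wab : 0 <= w * (a - b) ^+ 2 by rewrite mulr_ge0 ?sqr_ge0.
  lra.
set z := v + w in link_le *.
have z0 : 0 <= z by rewrite /z; lra.
have -> : u + v + w = u + z by rewrite /z addrA.
(* This is 324 times the difference 64/81 (u + z)^3 - 3 u z^2 - 3/4 z^3. *)
have sq : 0 <= (8 * u - z) ^+ 2 * (4 * u + 13 * z).
  by rewrite mulr_ge0 ?sqr_ge0 //; lra.
lra.
Qed.

(** * The pattern, its blow-ups and their edge counts *)

(* [inl true] is the class U, [inl false] the class W, and the [inr p] are the
   points into which the class V is split. *)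
Definition pattern_edge (I : finType) (Q : {set {set I}}) (c1 c2 c3 : bool + I) : bool :=
  match c1, c2, c3 with
  | inl true, c, d | c, inl true, d | c, d, inl true => (c != inl true) && (d != inl true)
  | inl false, inl false, inl false => false
  | inl false, inl false, inr _ | inl false, inr _, inl false
  | inr _, inl false, inl false => true
  | inl false, inr p, inr q | inr p, inl false, inr q | inr p, inr q, inl false => p != q
  | inr p, inr q, inr r => [set p; q; r] \in Q
  end.

Section Pattern.
Variables (I : finType) (Q : {set {set I}}).

Lemma pattern_edge_swapl c1 c2 c3 : pattern_edge Q c1 c2 c3 = pattern_edge Q c2 c1 c3.
Proof.
case: c1 => [[]|p]; case: c2 => [[]|q]; case: c3 => [[]|r] //=; first by rewrite eq_sym.
by rewrite (finset.setUC [set p]).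
Qed.

Lemma pattern_edge_swapr c1 c2 c3 : pattern_edge Q c1 c2 c3 = pattern_edge Q c1 c3 c2.
Proof.
case: c1 => [[]|p]; case: c2 => [[]|q]; case: c3 => [[]|r] //=; first by rewrite eq_sym.
by rewrite finset.setUAC.
Qed.

Lemma sum_color (R : nmodType) (F : bool + I -> R) :
  \sum_c F c = F (inl true) + F (inl false) + \sum_p F (inr p).
Proof. by rewrite big_sumType big_bool. Qed.

(** The terms count, in order, triples with one vertex in U, of type VWW, of type VVW at distinct
    points, and those from [Q]. The factors 3 are the positions of the exceptional vertex, except
    that in 3v(w^2) and 3w(v^2 - ...) it is the lone V or W vertex. *)
Lemma pattern_edge_sum (R : comPzRingType) (a : bool + I -> R) :
  let u := a (inl true) in let w := a (inl false) in let v := \sum_p a (inr p) in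
  \sum_c1 a c1 * (\sum_c2 a c2 * (\sum_c3 a c3 * (pattern_edge Q c1 c2 c3)%:R)) =
  3 * u * (v + w) ^+ 2 + 3 * v * w ^+ 2 + 3 * w * (v ^+ 2 - \sum_p a (inr p) ^+ 2)
  + \sum_p \sum_q \sum_r
      (if [set p; q; r] \in Q then a (inr p) * a (inr q) * a (inr r) else 0).
Proof.
move=> u w v.
pose h p q := \sum_r a (inr r) * ([set p; q; r] \in Q)%:R.
have sum1 : \sum_p a (inr p) * 1 = v by under eq_bigr do rewrite mulr1.
have sum0 : \sum_p a (inr p) * 0 = 0 by rewrite big1 // => p _; rewrite mulr0.
have sum_neq p : \sum_q a (inr q) * (p != q)%:R = v - a (inr p).
  rewrite /v (bigD1 p) //= eqxx mulr0 add0r [in RHS](bigD1 p) //= addrC addrK.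
  by apply: eq_bigr => q; rewrite eq_sym => ->; rewrite mulr1.
have inner c1 c2 : \sum_c3 a c3 * (pattern_edge Q c1 c2 c3)%:R =
    match c1, c2 with
    | inl true, inl true => 0
    | inl true, _ | _, inl true => w + v
    | inl false, inl false => u + v
    | inl false, inr p | inr p, inl false => u + w + v - a (inr p)
    | inr p, inr q => u + w * (p != q)%:R + h p q
    end.
  rewrite sum_color; case: c1 => [[]|p]; case: c2 => [[]|q];
    by rewrite /= ?sum1 ?sum0 ?sum_neq -/u -/w /h; ring.
have sumU : \sum_c2 a c2 * (\sum_c3 a c3 * (pattern_edge Q (inl true) c2 c3)%:R) = (v + w) ^+ 2.
  under eq_bigr do rewrite inner.
  by rewrite sum_color -mulr_suml -/u -/w -/v; ring.
have sumW : \sum_c2 a c2 * (\sum_c3 a c3 * (pattern_edge Q (inl false) c2 c3)%:R) =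
    2 * u * (v + w) + 2 * v * w + v ^+ 2 - \sum_p a (inr p) ^+ 2.
  under eq_bigr do rewrite inner.
  rewrite sum_color; under eq_bigr do rewrite mulrBr -expr2.
  by rewrite sumrB -mulr_suml -/u -/w -/v; ring.
have sumV p : \sum_c2 a c2 * (\sum_c3 a c3 * (pattern_edge Q (inr p) c2 c3)%:R) =
    2 * u * (v + w) + w ^+ 2 + 2 * w * (v - a (inr p)) + \sum_q a (inr q) * h p q.
  under eq_bigr do rewrite inner.
  rewrite sum_color; under eq_bigr do rewrite !mulrDr (mulrCA _ w).
  by rewrite 2!big_split /= -mulr_suml -mulr_sumr sum_neq -/u -/w -/v; ring.
have -> : \sum_p \sum_q \sum_r
    (if [set p; q; r] \in Q then a (inr p) * a (inr q) * a (inr r) else 0) =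
    \sum_p a (inr p) * \sum_q a (inr q) * h p q.
  apply: eq_bigr => p _; rewrite mulr_sumr; apply: eq_bigr => q _.
  rewrite mulrA mulr_sumr; apply: eq_bigr => r _.
  by case: ifP => _; rewrite ?mulr1 // !mulr0.
rewrite sum_color.
under [X in _ + X = _]eq_bigr do
  rewrite sumV mulrDr mulrDr (mulrCA _ (2 * w)) mulrBr -expr2.
rewrite sumU sumW -/u -/w.
by rewrite !big_split /= -!mulr_sumr sumrB -!mulr_suml -/v; ring.
Qed.

(** Asking for all orderings of [e] avoids choosing one; by symmetry of the pattern any single
    ordering decides membership. *)
Definition blowup n (phi : 'I_n -> bool + I) : {set {set 'I_n}} :=
  [set e : {set 'I_n} | (#|e| == 3%N) &&
    [forall i, forall j, forall k,
      ([set i; j; k] == e) ==> pattern_edge Q (phi i) (phi j) (phi k)]].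

Lemma mem_blowup n (phi : 'I_n -> bool + I) (i j k : 'I_n) : #|[set i; j; k]| = 3%N ->
  ([set i; j; k] \in blowup phi) = pattern_edge Q (phi i) (phi j) (phi k).
Proof.
move=> ijk3; rewrite inE ijk3 eqxx /=; apply/idP/idP => [|ijk].
  by move=> /forallP/(_ i)/forallP/(_ j)/forallP/(_ k)/implyP/(_ (eqxx _)).
have jik : pattern_edge Q (phi j) (phi i) (phi k) by rewrite pattern_edge_swapl.
have ikj : pattern_edge Q (phi i) (phi k) (phi j) by rewrite pattern_edge_swapr.
have jki : pattern_edge Q (phi j) (phi k) (phi i) by rewrite pattern_edge_swapr.
have kij : pattern_edge Q (phi k) (phi i) (phi j) by rewrite pattern_edge_swapl.
have kji : pattern_edge Q (phi k) (phi j) (phi i) by rewrite pattern_edge_swapr.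
apply/forallP => x; apply/forallP => y; apply/forallP => z; apply/implyP.
rewrite set3_eq // !inE -!orbA => /and3P[/or3P[]/eqP-> /andP[yx] /or3P[]/eqP yE];
  by move=> /and3P[zy zx] /or3P[]/eqP zE; move: yx zy zx; rewrite yE zE ?eqxx.
Qed.

Lemma blowup_uniform n (phi : 'I_n -> bool + I) : is_uniform 3 (blowup phi).
Proof. by apply/forallP => e; apply/implyP; rewrite inE => /andP[]. Qed.

Definition blowup_graph n (phi : 'I_n -> bool + I) : rgraph 3 n :=
  exist (fun E => is_uniform 3 E) _ (blowup_uniform phi).

(** Triples with repeated vertices are counted too, so that the count is exactly a polynomial in the
    class sizes. *)
Definition num_pattern n (phi : 'I_n -> bool + I) : nat :=
  \sum_i \sum_j \sum_k pattern_edge Q (phi i) (phi j) (phi k).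

Lemma card3_set3 n (E : {set {set 'I_n}}) : is_uniform 3 E ->
  (6 * #|E| = \sum_i \sum_j \sum_k ([set i; j; k] \in E))%N.
Proof.
move=> /forallP E3.
have E3' e : e \in E -> #|e| = 3%N by move=> eE; apply/eqP; exact: (implyP (E3 e)).
have := sum_set3 (fun=> 1%N) E3'; rewrite -mulr_natl natn.
rewrite -[RHS]/(6 * \sum_(e in E) 1)%N sum1_card => <-.
apply: eq_bigr => i _; apply: eq_bigr => j _; apply: eq_bigr => k _.
by case: (_ \in E).
Qed.

(** A pattern triple that is not an ordering of an edge has two equal entries: three choices of the
    pair of positions, n^2 triples each. *)
Lemma num_pattern_le n (phi : 'I_n -> bool + I) :
  (num_pattern phi <= 6 * #|edges (blowup_graph phi)| + 3 * n ^ 2)%N.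
Proof.
rewrite card3_set3; last exact: blowup_uniform.
pose d (x y : 'I_n) : nat := (x == y).
apply: (@leq_trans (\sum_i \sum_j \sum_k
    (([set i; j; k] \in blowup phi) + (d i j + (d j k + d i k))))%N).
  apply: leq_sum => i _; apply: leq_sum => j _; apply: leq_sum => k _.
  have edge_le1 := leq_b1 (pattern_edge Q (phi i) (phi j) (phi k)).
  rewrite /d; case: eqVneq => [_|ij]; first by lia.
  case: eqVneq => [_|jk]; first by lia.
  case: eqVneq => [_|ik]; first by lia.
  rewrite mem_blowup ?addn0 //.
  by rewrite -finset.setUC cardsU1 cards2 !inE ij (eq_sym k) (negbTE ik) (eq_sym k) (negbTE jk).
have sum_d (x : 'I_n) : (\sum_y d x y = 1)%N.
  by rewrite (bigD1 x) //= /d eqxx big1 // => y; rewrite eq_sym => /negbTE->.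
have sum_cst (m : nat) : (\sum_(i < n) m = n * m)%N by rewrite sum_nat_const card_ord.
apply: eq_leq.
under eq_bigr => i _.
  under eq_bigr => j _ do rewrite !big_split /= sum_cst !sum_d.
  rewrite !big_split /= -big_distrr /= sum_d !sum_cst.
  over.
by rewrite !big_split /= !sum_cst; congr (_ + _)%N; ring.
Qed.

(** A copy of [H] in a blow-up pulls the colouring back to the vertices of [H], so only [m] vertices
    matter from here on. *)
Lemma edges_le_num_good m n (phi : 'I_n -> bool + I) (H : rgraph 3 m) (f : 'I_m -> 'I_n) :
    injective f -> (forall e : {set 'I_m}, e \in edges H -> f @: e \in blowup phi) ->
  (6 * #|edges H| <= num_pattern (phi \o f))%N.
Proof.
move=> f_inj fE; rewrite card3_set3; last exact: valP.
apply: leq_sum => i _; apply: leq_sum => j _; apply: leq_sum => k _.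
case: (boolP (_ \in _)) => // ijkH.
have f3 : f @: [set i; j; k] = [set f i; f j; f k] by rewrite !imsetU !imset_set1.
have := fE _ ijkH; rewrite f3 mem_blowup => [->//|].
have /forallP/(_ [set i; j; k])/implyP/(_ ijkH)/eqP := valP H.
by rewrite -f3 card_imset.
Qed.

Definition class_size n (phi : 'I_n -> bool + I) c : nat := #|[set i | phi i == c]|.

Lemma num_patternE (R : comPzRingType) n (phi : 'I_n -> bool + I) :
  let a c : R := (class_size phi c)%:R in
  (num_pattern phi)%:R =
  \sum_c1 a c1 * (\sum_c2 a c2 * (\sum_c3 a c3 * (pattern_edge Q c1 c2 c3)%:R)).
Proof.
move=> a.
have by_color (F : bool + I -> R) : \sum_i F (phi i) = \sum_c a c * F c.
  rewrite (partition_big phi predT) //=; apply: eq_bigr => c _.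
  rewrite (eq_bigr (fun=> F c)) => [|i /eqP->//].
  rewrite sumr_const mulr_natl; congr (_ *+ _).
  by apply: eq_card => i; rewrite inE.
rewrite natr_sum -by_color; apply: eq_bigr => i _.
rewrite natr_sum -by_color; apply: eq_bigr => j _.
by rewrite natr_sum -by_color.
Qed.

(** The class sizes at the points of V are weights of total at most [m], so the layer-cake bound
    supplies the pair required by [pattern_poly_le]. *)
Lemma num_pattern_sparse_le (R : realFieldType) (m : nat) (phi : 'I_m -> bool + I) :
    (forall e, e \in Q -> #|e| = 3%N) ->
    (forall A : {set I}, (#|A| <= m)%N -> (#|[set e in Q | e \subset A]| <= #|A| - 2)%N) ->
  (num_pattern phi)%:R <= 64 / 81 * m%:R ^+ 3 :> R.
Proof.
move=> Q3 Qsparse.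
have sum_size : (\sum_c class_size phi c = m)%N.
  rewrite -[RHS]card_ord -sum1_card (partition_big phi predT) //=.
  by apply: eq_bigr => c _; rewrite /class_size -sum1_card; apply: eq_bigl => i; rewrite inE.
have sizeE := sum_size; rewrite big_sumType big_bool /= in sizeE.
have [||x [y [xyv xys xyq]]] := @sparse_weight_le _ Q m (fun p => class_size phi (inr p)) Q3.
- exact: Qsparse.
- by rewrite -{2}sizeE leq_addl.
rewrite num_patternE pattern_edge_sum.
have -> : m%:R = (class_size phi (inl true))%:R + (class_size phi (inl false))%:R
    + \sum_p (class_size phi (inr p))%:R :> R by rewrite -natr_sum -!natrD sizeE.
have -> : \sum_p (class_size phi (inr p))%:R ^+ 2 =
    (\sum_p class_size phi (inr p) ^ 2)%N%:R :> R.
  by rewrite natr_sum; apply: eq_bigr => p _; rewrite natrX.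
set q := (X in _ + X <= _).
have qE : q = (\sum_p \sum_q \sum_r (if [set p; q; r] \in Q then
    class_size phi (inr p) * class_size phi (inr q) * class_size phi (inr r) else 0))%N%:R.
  rewrite natr_sum; apply: eq_bigr => p1 _; rewrite natr_sum; apply: eq_bigr => p2 _.
  by rewrite natr_sum; apply: eq_bigr => p3 _; case: ifP; rewrite // !natrM.
rewrite (addrAC (class_size phi (inl true))%:R).
apply: (@pattern_poly_le _ _ _ _ x%:R y%:R); rewrite ?ler0n //.
- by rewrite -natr_sum -natrD ler_nat.
- by rewrite -!natrX -natrD ler_nat.
- by rewrite qE -natr_sum -!natrB ?leq_subRL ?(leq_trans (leq_addr _ _) xyv) // -!natrM ler_nat.
Qed.

End Pattern.

(** * Balanced blow-ups and the choice of parameters *)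

(** Enumerate the disjoint union of the sets ['I_(s c)] and colour each element by its tag. *)
Lemma exists_coloring (C : finType) (s : C -> nat) :
  exists phi : 'I_(\sum_c s c) -> C, forall c, #|[set i | phi i == c]| = s c.
Proof.
pose T := {c : C & 'I_(s c)}.
have cardT : #|{: T}| = (\sum_c s c)%N.
  by rewrite card_tagged sumnE big_map big_enum /=; apply: eq_bigr => c _; rewrite card_ord.
rewrite -cardT; exists (fun i => tag (enum_val i : T)) => c.
pose emb (j : 'I_(s c)) : 'I_#|{: T}| := enum_rank (Tagged (fun c => 'I_(s c)) j).
have emb_inj : injective emb by move=> j k /enum_rank_inj/eqP; rewrite eq_Tagged => /eqP.
have <- : #|emb @: finset.setT| = s c by rewrite card_imset // cardsT card_ord.
apply: eq_card => i.
rewrite inE; apply/eqP/imsetP => [ic|[j _ ->]]; last by rewrite enum_rankK.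
move: ic (enum_valK i); case: (enum_val i) => c' j /= c'c; case: _ / c'c in emb emb_inj *.
by move=> <-; exists j.
Qed.

Lemma natr_bin3 (R : realFieldType) n :
  6 * 'C(n, 3)%:R = n%:R * (n%:R - 1) * (n%:R - 2) :> R.
Proof.
have -> : 6 * 'C(n, 3)%:R = (n ^_ 3)%:R :> R by rewrite -bin_ffact natrM mulrC.
case: n => [|[|n]]; rewrite ?ffact0n ?mul0r // ?subrr ?mulr0 ?mul0r //.
by rewrite !ffactnS ffactn0 muln1 /= !natrM -!natr1; ring.
Qed.

(** The weights 1/9, 4/9, 4/9 scaled to the total 9k|I|, with V split evenly over the points. *)
Definition blowup_size (I : finType) (k : nat) (c : bool + I) : nat :=
  match c with inl true => k * #|I| | inl false => 4 * (k * #|I|) | inr _ => 4 * k end.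

(** Here 576 |I|^3 = 64/81 (9|I|)^3 is the base density, 192 |I|^2 the loss from pairs at one point
    of V, and 384 |Q| the gain; the gain wins exactly when 2|Q| > |I|^2. *)
Lemma num_pattern_blowup (R : comPzRingType) (I : finType) (Q : {set {set I}}) (k n : nat)
    (phi : 'I_n -> bool + I) :
    (forall e, e \in Q -> #|e| = 3%N) -> (forall c, class_size phi c = blowup_size k c) ->
  (num_pattern Q phi)%:R = k%:R ^+ 3 *
    (576 * #|I|%:R ^+ 3 - 192 * #|I|%:R ^+ 2 + 384 * #|Q|%:R) :> R.
Proof.
move=> Q3 size_phi; rewrite num_patternE pattern_edge_sum !size_phi /=.
have sum_size (f : nat -> R) :
    \sum_p f (class_size phi (inr p)) = #|I|%:R * f (4 * k)%N.
  under eq_bigr do rewrite size_phi /=.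
  by rewrite sumr_const mulr_natl.
rewrite (sum_size (fun x => x%:R)) (sum_size (fun x => x%:R ^+ 2)).
have -> : \sum_p \sum_q \sum_r (if [set p; q; r] \in Q then
    (class_size phi (inr p))%:R * (class_size phi (inr q))%:R * (class_size phi (inr r))%:R
    else 0) = 6 * (#|Q|%:R * (4 * k%:R) ^+ 3) :> R.
  rewrite mulr_natl mulr_natl -sumr_const -(sum_set3 (fun=> (4 * k%:R : R) ^+ 3) Q3).
  apply: eq_bigr => p _; apply: eq_bigr => q _; apply: eq_bigr => r _.
  by rewrite !size_phi /= natrM; case: ifP => _ //; ring.
rewrite !natrM; ring.
Qed.

Theorem theorem1p5 (R : realType) : ~ jump 3 (64 / 81 : R).
Proof.
apply/not_jumpP => c c0.
have [m m3 m_large] : exists2 m, (3 <= m)%N &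
    64 / 81 * m%:R ^+ 3 <= (64 / 81 + c / 2) * (6 * 'C(m, 3)%:R) :> R.
  (* Comparing 64/81 m^3 with (64/81 + c/2) m (m - 1) (m - 2), the cubic surplus c/2 m^3 beats the
     quadratic loss 3 (64/81 + c/2) m^2 once m exceeds [x]. *)
  pose x : R := 6 * (64 / 81 + c / 2) / c.
  exists (Num.bound x + 3)%N; first by rewrite leq_addl.
  have : x < (Num.bound x + 3)%:R.
    rewrite natrD; apply: (lt_le_trans (y := (Num.bound x)%:R)); last by rewrite lerDl.
    by apply: archi_boundP; rewrite divr_ge0 ?mulr_ge0 //; lra.
  rewrite natr_bin3 ltr_pdivrMr //; move: (_ + 3)%N => m xm.
  have m2 : 0 <= m%:R ^+ 2 :> R by rewrite sqr_ge0.
  have m0 : 0 <= m%:R :> R by [].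
  have h1 : 0 <= m%:R ^+ 2 * (m%:R * c - 6 * (64 / 81 + c / 2)).
    by rewrite mulr_ge0 // subr_ge0 ltW.
  have h2 : 0 <= c * m%:R by rewrite mulr_ge0 // ltW.
  lra.
pose B : R := (64 / 81 + c / 2) * 'C(m, 3)%:R.
pose F : family 3 := fun m' H => m' = m /\ B < #|edges H|%:R.
have B0 : 0 <= B by rewrite mulr_ge0 //; lra.
exists F; apply/andP; split; last first.
  apply: (le_lt_trans (turan_density_le _ _ m3)).
  rewrite ltr_pdivrMr ?ltr0n ?bin_gt0 //.
  apply: (@le_lt_trans _ _ B); last first.
    by rewrite ltr_pM2r ?ltr0n ?bin_gt0 //; lra.
  rewrite /turan_number; elim/big_ind: _ => [//|x y Bx By|G /asboolP FG].
    by rewrite /maxn; case: ifP.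
  rewrite leNgt; apply/negP => BG; apply: (FG m G) => //.
  by exists id; split=> // e; rewrite imset_id.
have [t [Q [Q3 Qbig Qsparse]]] := sparse_triples m.
have t0 : (0 < t)%N.
  case: (finset.set_0Vmem Q) => [Q0|[e eQ]]; first by rewrite Q0 cards0 in Qbig.
  by have := max_card (mem e); rewrite Q3 // card_ord; case: (t).
(* As 2|Q| >= t^2 + 1, the pattern count exceeds its base value by at least 192 k^3. Half of this is
   [eps] n^3 with n = 9kt; the other half pays for the 3 n^2 degenerate triples. *)
pose eps : R := 96 / (9 * t%:R) ^+ 3.
have t0R : 0 < t%:R :> R by rewrite ltr0n.
have eps0 : 0 < eps by rewrite divr_gt0 // exprn_gt0 // mulr_gt0.
apply: (@lt_le_trans _ _ (64 / 81 + eps)); first by rewrite ltrDl.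
apply: turan_density_ge => N.
(* k >= 3 t^2 gives 96 k^3 >= 3 n^2 = 243 k^2 t^2, and the summand [N] pushes n past [N]. *)
pose k := (3 * t ^ 2 + N + 1)%N.
have [phi size_phi] := exists_coloring (@blowup_size 'I_t k).
set n := (X in 'I_X -> _) in phi size_phi.
have nE : n = (9 * (k * t))%N.
  rewrite /n big_sumType big_bool /= sum_nat_const card_ord; lia.
have n_gt : (3 + N <= n)%N by rewrite nE /k; nia.
exists n; first exact: leq_trans (leq_addl _ _) n_gt.
(* A member of [F] inside the blow-up would have 6|H| at most 64/81 m^3, hence at most 6B by the
   choice of [m]. *)
have free : is_free F (blowup_graph Q phi).
  move=> m' H [m'm BH] [f [f_inj fE]]; subst m'.
  have := edges_le_num_good f_inj fE.
  rewrite -(ler_nat R) => /le_trans/(_ (num_pattern_sparse_le R (phi \o f) Q3 Qsparse)).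
  move=> /le_trans/(_ m_large); rewrite leNgt mulrCA natrM ltr_pM2l // BH.
  by [].
have ex_big : (num_pattern Q phi <= 6 * turan_number n F + 3 * n ^ 2)%N.
  apply: leq_trans (num_pattern_le Q phi) _.
  by rewrite leq_add2r leq_mul2l leq_turan_number // orbT.
move: ex_big; rewrite -(ler_nat R) natrD (natrM _ 6) (natrM _ 3) natrX.
rewrite (num_pattern_blowup _ Q3 size_phi) card_ord.
have n3 : (3 <= n)%N := leq_trans (leq_addr _ _) n_gt.
rewrite ler_pdivlMr ?ltr0n ?bin_gt0 //.
set ex := (turan_number n F)%:R => ex_big.
have qT : t%:R ^+ 2 + 1 <= 2 * #|Q|%:R :> R by rewrite -natrX -natrM natr1 ler_nat.
have kT : 3 * t%:R ^+ 2 <= k%:R :> R by rewrite -natrX -natrM ler_nat /k; lia.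
have nR : n%:R = 9 * (k%:R * t%:R) :> R by rewrite nE !natrM.
have n1 : 1 <= n%:R :> R by rewrite ler1n (leq_trans _ n3).
have bin_le : 6 * 'C(n, 3)%:R <= n%:R ^+ 3 :> R.
  have : 0 <= n%:R * (n%:R - 1) :> R by rewrite mulr_ge0 // subr_ge0.
  by rewrite natr_bin3; lra.
have eps_bin : 6 * ((64 / 81 + eps) * 'C(n, 3)%:R) <= 576 * (k%:R * t%:R) ^+ 3 + 96 * k%:R ^+ 3.
  have -> : 576 * (k%:R * t%:R) ^+ 3 + 96 * k%:R ^+ 3 = (64 / 81 + eps) * n%:R ^+ 3.
    by rewrite nR /eps; field; rewrite gt_eqF.
  by rewrite mulrCA ler_wpM2l // addr_ge0 ?(ltW eps0).
have k3 : 0 <= k%:R ^+ 3 * (2 * #|Q|%:R - (t%:R ^+ 2 + 1)) :> R.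
  by rewrite mulr_ge0 ?exprn_ge0 // subr_ge0.
have k2 : 0 <= k%:R ^+ 2 * (k%:R - 3 * t%:R ^+ 2) :> R.
  by rewrite mulr_ge0 ?exprn_ge0 // subr_ge0.
have k0 : 0 <= k%:R ^+ 3 :> R by rewrite exprn_ge0.
by rewrite nR in ex_big; lra.
Qed.
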